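(* Let $\{R_\lambda\}_{\lambda\in\Lambda}$ be a family of commutative rings with unity and let $R=\prod_{\lambda\in\Lambda}R_\lambda$. Then $R$ is a $PW$-ring (resp. $UPW$-ring) if and only if $R_\lambda$ is a $PW$-ring (resp. $UPW$-ring) for every $\lambda\in\Lambda$.
   Context: A commutative ring $S$ with unity is a $PW$-ring (resp. $UPW$-ring) if for all $a,b\in S$ with $aS\cap bS=0$ the ideal $\mathrm{Ann}(a)+\mathrm{Ann}(b)$ contains a regular element, i.e. a non-zero-divisor (resp. a unit), where $\mathrm{Ann}(a)=\{s\in S: sa=0\}$. *)

(* Defs.v *)
From HB Require Import structures.
From mathcomp Require Import all_boot all_order all_algebra.
From mathcomp Require Import boolp classical_sets.

Set Implicit Arguments.
Unset Strict Implicit.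
Unset Printing Implicit Defensive.

Import GRing.Theory.
Local Open Scope classical_set_scope.
Local Open Scope ring_scope.

(* An alias, so that the componentwise operations below do not overlap with
   the instances that functions.v declares on non-dependent function types. *)
Definition prod_ring (I : Type) (R : I -> comPzRingType) : Type :=
  forall i : I, R i.

Section ProdRing.
Variables (I : Type) (R : I -> comPzRingType).
Implicit Types f g h : prod_ring R.

HB.instance Definition _ :=
  Choice.copy (prod_ring R) (forall i : I, R i).

Definition prod_ring_zero : prod_ring R := fun i => 0.
Definition prod_ring_one : prod_ring R := fun i => 1.
Definition prod_ring_opp f : prod_ring R := fun i => - f i.
Definition prod_ring_add f g : prod_ring R := fun i => f i + g i.
Definition prod_ring_mul f g : prod_ring R := fun i => f i * g i.

Lemma prod_ring_addA : associative prod_ring_add.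
Proof. by move=> f g h; apply: functional_extensionality_dep => i; apply: addrA. Qed.

Lemma prod_ring_addC : commutative prod_ring_add.
Proof. by move=> f g; apply: functional_extensionality_dep => i; apply: addrC. Qed.

Lemma prod_ring_add0 : left_id prod_ring_zero prod_ring_add.
Proof. by move=> f; apply: functional_extensionality_dep => i; apply: add0r. Qed.

Lemma prod_ring_addN :
  left_inverse prod_ring_zero prod_ring_opp prod_ring_add.
Proof. by move=> f; apply: functional_extensionality_dep => i; apply: addNr. Qed.

HB.instance Definition _ := GRing.isZmodule.Build (prod_ring R)
  prod_ring_addA prod_ring_addC prod_ring_add0 prod_ring_addN.

Lemma prod_ring_mulA : associative prod_ring_mul.
Proof. by move=> f g h; apply: functional_extensionality_dep => i; apply: mulrA. Qed.

Lemma prod_ring_mulC : commutative prod_ring_mul.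
Proof. by move=> f g; apply: functional_extensionality_dep => i; apply: mulrC. Qed.

Lemma prod_ring_mul1 : left_id prod_ring_one prod_ring_mul.
Proof. by move=> f; apply: functional_extensionality_dep => i; apply: mul1r. Qed.

Lemma prod_ring_mulDl : left_distributive prod_ring_mul +%R.
Proof. by move=> f g h; apply: functional_extensionality_dep => i; apply: mulrDl. Qed.

HB.instance Definition _ := GRing.Zmodule_isComPzRing.Build (prod_ring R)
  prod_ring_mulA prod_ring_mulC prod_ring_mul1 prod_ring_mulDl.

End ProdRing.

Section PW.
Variable S : comPzRingType.
Implicit Types (a b s x y : S) (A B : set S).

Definition annihilator a : set S := [set s | s * a = 0].

Definition principal_ideal a : set S := [set a * s | s in [set: S]].

Definition ideal_sum A B : set S := [set x + y | x in A & y in B].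

Definition regular x : Prop := GRing.lreg x.

(* [GRing.unit] needs a unitRingType, which an arbitrary commutative ring (or
   an infinite product of them) does not carry. *)
Definition invertible x : Prop := exists y, x * y = 1.

Definition PW_ring : Prop :=
  forall a b : S, principal_ideal a `&` principal_ideal b = [set 0] ->
    exists2 r, ideal_sum (annihilator a) (annihilator b) r & regular r.

Definition UPW_ring : Prop :=
  forall a b : S, principal_ideal a `&` principal_ideal b = [set 0] ->
    exists2 u, ideal_sum (annihilator a) (annihilator b) u & invertible u.

End PW.

Arguments PW_ring S : clear implicits.
Arguments UPW_ring S : clear implicits.

(* Main.v *)
Require Import Defs.
From mathcomp Require Import all_boot all_order all_algebra.
From mathcomp Require Import boolp classical_sets.

(** Every ingredient of the two properties is componentwise: principal ideals
    of the product meet trivially iff they do so in each coordinate, annihilators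
    are products of annihilators, and regular elements and units are the families
    of such.  A pair in one factor is extended by zero to the product; in
    the other direction a witness is chosen in each coordinate. *)

Set Implicit Arguments.
Unset Strict Implicit.
Unset Printing Implicit Defensive.

Import GRing.Theory.
Local Open Scope classical_set_scope.
Local Open Scope ring_scope.

Section DisjointIdeals.
Variable S : comPzRingType.
Implicit Types a b s t : S.

(** A common element of the two ideals is a value [a * s = b * t], and 0 always is one, so only one
    inclusion has content. *)
Lemma principal_ideals_disjointP a b :
  principal_ideal a `&` principal_ideal b = [set 0] <->
  forall s t, a * s = b * t -> a * s = 0.
Proof.
split=> [ab0 s t st | ab0].
  suff : [set 0] (a * s) by [].
  by rewrite -ab0; split; [exists s | exists t].
apply/seteqP; split=> [z [[s _ <-] [t _ /esym st]] | z ->]; first exact: ab0 st.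
by split; exists 0; rewrite ?mulr0.
Qed.

Lemma principal_ideals_disjoint00 :
  principal_ideal (0 : S) `&` principal_ideal 0 = [set 0].
Proof. by apply/principal_ideals_disjointP => s t _; rewrite mul0r. Qed.

End DisjointIdeals.

Section Product.
Variables (I : Type) (R : I -> comPzRingType).
Implicit Types f g h : prod_ring R.

(** Equality of indices is decided classically, as [I] is an arbitrary type. Only the two equations
    on [g] are exported, which hides the dependent cast. *)
Lemma prod_ring_update f (i : I) (x : R i) :
  exists2 g : prod_ring R, g i = x & forall j, j <> i -> g j = f j.
Proof.
exists (@dfwith {classic I} R f i x); first exact: dfwith_in.
by move=> j ji; apply: dfwith_out; apply/eqP => /esym.
Qed.

Lemma prod_ringP f g : f = g <-> forall i, f i = g i.
Proof. by split=> [-> // | ]; exact: functional_extensionality_dep. Qed.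

Lemma prod_principal_ideals_disjoint f g :
  principal_ideal f `&` principal_ideal g = [set 0] <->
  forall i, principal_ideal (f i) `&` principal_ideal (g i) = [set 0].
Proof.
split=> [/principal_ideals_disjointP fg0 i | fg0].
  apply/principal_ideals_disjointP => x y xy.
  (* Extended by zero, [x] and [y] give products that agree at [i] by [xy] and vanish elsewhere. *)
  have [s si s0] := prod_ring_update 0 x.
  have [t ti t0] := prod_ring_update 0 y.
  have /fg0 /prod_ringP/(_ i) : f * s = g * t.
    apply/prod_ringP => j; change (f j * s j = g j * t j).
    have [ji|ji] := pselect (j = i); first by subst j; rewrite si ti.
    by rewrite (s0 _ ji) (t0 _ ji) !mulr0.
  by change (f i * s i = 0 -> f i * x = 0); rewrite si.
apply/principal_ideals_disjointP => s t st; apply/prod_ringP => i.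
move/principal_ideals_disjointP: (fg0 i); apply.
exact: (prod_ringP _ _).1 st i.
Qed.

Lemma prod_regular f : regular f <-> forall i, regular (f i).
Proof.
split=> [freg i x y xy | freg g h fgh].
  have [s si s0] := prod_ring_update 0 x.
  have [t ti t0] := prod_ring_update 0 y.
  have /freg st : f * s = f * t.
    apply/prod_ringP => j; change (f j * s j = f j * t j).
    have [ji|ji] := pselect (j = i); first by subst j; rewrite si ti.
    by rewrite (s0 _ ji) (t0 _ ji).
  by rewrite -si -ti st.
apply/prod_ringP => i; apply: (freg i).
exact: (prod_ringP _ _).1 fgh i.
Qed.

Lemma prod_invertible f : invertible f <-> forall i, invertible (f i).
Proof.
split=> [[g fg] i | finv]; first by exists (g i); exact: (prod_ringP _ _).1 fg i.
exists (fun i => projT1 (cid (finv i))); apply/prod_ringP => i.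
exact: projT2 (cid (finv i)).
Qed.

(** The argument uses only that [Q] is tested coordinatewise, so one proof serves both regular and
    invertible elements. *)
Lemma prod_annihilator_sum (Q : forall S : comPzRingType, S -> Prop) :
  (forall f, Q _ f <-> forall i, Q _ (f i)) ->
  let P (S : comPzRingType) := forall a b : S,
    principal_ideal a `&` principal_ideal b = [set 0] ->
    exists2 r, ideal_sum (annihilator a) (annihilator b) r & Q S r in
  P (prod_ring R) <-> forall i, P (R i).
Proof.
move=> Qprod P; split=> [PR i a b ab0 | PR f g /prod_principal_ideals_disjoint fg0].
  have [f fi f0] := prod_ring_update 0 a.
  have [g gi g0] := prod_ring_update 0 b.
  (* Away from [i] the pair is [(0, 0)], whose ideals meet trivially; at [i] it is [(a, b)]. *)
  have [|_ [x xf [y yg <-]] /Qprod/(_ i) Qxy] := PR f g.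
    apply/prod_principal_ideals_disjoint => j.
    have [ji|ji] := pselect (j = i); first by subst j; rewrite fi gi.
    rewrite (f0 _ ji) (g0 _ ji); exact: principal_ideals_disjoint00.
  exists (x i + y i) => //; exists (x i).
    by rewrite -fi; exact: (prod_ringP _ _).1 xf i.
  by exists (y i) => //; rewrite -gi; exact: (prod_ringP _ _).1 yg i.
(* Both summands are packed into one pair, so that a single choice per coordinate keeps [Q] of their
   sum. *)
have xyP i : exists xy : R i * R i,
    [/\ xy.1 * f i = 0, xy.2 * g i = 0 & Q _ (xy.1 + xy.2)].
  by have [_ [x xf [y yg <-]] Qxy] := PR i _ _ (fg0 i); exists (x, y).
pose xy i := projT1 (cid (xyP i)).
pose x : prod_ring R := fun i => (xy i).1.
pose y : prod_ring R := fun i => (xy i).2.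
exists (x + y); last by apply/Qprod => i; have [] := projT2 (cid (xyP i)).
exists x; first by apply/prod_ringP => i; have [] := projT2 (cid (xyP i)).
by exists y => //; apply/prod_ringP => i; have [] := projT2 (cid (xyP i)).
Qed.

End Product.

Theorem proposition4p4 (Lambda : Type) (R : Lambda -> comPzRingType) :
  (PW_ring (prod_ring R) <-> forall l : Lambda, PW_ring (R l)) /\
  (UPW_ring (prod_ring R) <-> forall l : Lambda, UPW_ring (R l)).
Proof.
split.
- exact: prod_annihilator_sum (@regular) (@prod_regular _ R).
- exact: prod_annihilator_sum (@invertible) (@prod_invertible _ R).
Qed.
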